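(* Let $\mathcal{C}$ be a bounded above graded poset and let $H:\mathcal{C}\to\mathrm{Ab}$ be a functor. Then $H$ is an injective object of the abelian category $\mathrm{Ab}^{\mathcal{C}}$ if and only if both of the following hold: (1) $\operatorname{Ker}(i_0)$ is an injective object of $\mathrm{Ab}$ for each object $i_0$ of $\mathcal{C}$; (2) $H$ is pseudo-injective.
   Context: A poset is regarded as a category with exactly one arrow $p\to p'$ when $p\le p'$ and none otherwise. For $p<p'$, $p$ precedes $p'$ if $p\le p''\le p'$ implies $p''=p$ or $p''=p'$. A graded poset is a poset together with an (increasing) degree function $\deg:\mathrm{Ob}(\mathcal{C})\to\mathbb{Z}$ which is strictly order preserving and such that $\deg(p')=\deg(p)+1$ whenever $p$ precedes $p'$. It is bounded above if the set of values of $\deg$ has an upper bound. The degree of an arrow $p\to p'$ is $|\deg(p')-\deg(p)|$. For $H:\mathcal{C}\to\mathrm{Ab}$ and an object $i_0$, $\operatorname{Ker}(i_0)=\bigcap_{\alpha:i_0\to i,\ \alpha\ne 1_{i_0}}\ker H(\alpha)$ (equal to $H(i_0)$ if there is no such $\alpha$). $H$ is pseudo-injective if for every integer $d\ge 0$ the following holds: for any object $i_0$, any family of pairwise different objects $\{i_j\}_{j\in J}$, arrows $\alpha_j:i_0\to i_j$ with $\deg(\alpha_j)=d$ and elements $x_j\in\operatorname{Ker}(i_j)$ ($j\in J$), there is $y\in H(i_0)$ with $H(\alpha_j)(y)=x_j$ for every $j\in J$. *)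

(* Defs.v *)
From HB Require Import structures.
From mathcomp Require Import all_boot all_order all_algebra.
From mathcomp Require Import boolp.

Set Implicit Arguments.
Unset Strict Implicit.
Unset Printing Implicit Defensive.

Import Order.TTheory GRing.Theory Num.Theory.
Local Open Scope ring_scope.

Record category := Category {
  ob :> Type;
  arrow : ob -> ob -> Type;
  idm : forall A : ob, arrow A A;
  catcomp : forall A B D : ob, arrow B D -> arrow A B -> arrow A D;
  _ : forall (A B : ob) (f : arrow A B), catcomp (idm B) f = f;
  _ : forall (A B : ob) (f : arrow A B), catcomp f (idm A) = f;
  _ : forall (A B D E : ob) (h : arrow D E) (g : arrow B D) (f : arrow A B),
      catcomp h (catcomp g f) = catcomp (catcomp h g) f }.

Arguments idm {c} A.
Arguments catcomp {c A B D} g f.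

Lemma cat_id_left (C : category) (A B : C) (f : arrow A B) :
  catcomp (idm B) f = f.
Proof. by case: C A B f. Qed.

Lemma cat_id_right (C : category) (A B : C) (f : arrow A B) :
  catcomp f (idm A) = f.
Proof. by case: C A B f. Qed.

Lemma cat_assoc (C : category) (A B D E : C)
    (h : arrow D E) (g : arrow B D) (f : arrow A B) :
  catcomp h (catcomp g f) = catcomp (catcomp h g) f.
Proof. by case: C A B D E h g f. Qed.

Definition monomorphism (C : category) (A B : C) (m : arrow A B) : Prop :=
  forall (Z : C) (u v : arrow Z A), catcomp m u = catcomp m v -> u = v.

Definition injective_object (C : category) (I : C) : Prop :=
  forall (A B : C) (m : arrow A B), monomorphism m ->
  forall g : arrow A I, exists h : arrow B I, catcomp h m = g.

Record functor (C D : category) := Functor {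
  fob :> C -> D;
  fmap : forall A B : C, arrow A B -> arrow (fob A) (fob B);
  functor_id : forall A : C, fmap (idm A) = idm (fob A);
  functor_comp : forall (A B E : C) (g : arrow B E) (f : arrow A B),
      fmap (catcomp g f) = catcomp (fmap g) (fmap f) }.

Arguments fmap {C D} f {A B} _ : rename.

Record nat_trans (C D : category) (F G : functor C D) := NatTrans {
  component :> forall A : C, arrow (F A) (G A);
  naturality : forall (A B : C) (f : arrow A B),
      catcomp (component B) (fmap F f) = catcomp (fmap G f) (component A) }.

Lemma nat_trans_ext (C D : category) (F G : functor C D) (s t : nat_trans F G) :
  (forall A, s A = t A) -> s = t.
Proof.
case: s t => s sn [t tn] /= st.
have E : s = t by apply: functional_extensionality_dep.
by subst t; congr NatTrans; apply: Prop_irrelevance.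
Qed.

Lemma nat_id_subproof (C D : category) (F : functor C D) (A B : C)
    (f : arrow A B) :
  catcomp (idm (F B)) (fmap F f) = catcomp (fmap F f) (idm (F A)).
Proof. by rewrite cat_id_left cat_id_right. Qed.

Definition nat_id (C D : category) (F : functor C D) : nat_trans F F :=
  NatTrans (@nat_id_subproof C D F).

Lemma nat_comp_subproof (C D : category) (F G K : functor C D)
    (t : nat_trans G K) (s : nat_trans F G) (A B : C) (f : arrow A B) :
  catcomp (catcomp (t B) (s B)) (fmap F f) =
  catcomp (fmap K f) (catcomp (t A) (s A)).
Proof. by rewrite -cat_assoc naturality !cat_assoc naturality. Qed.

Definition nat_comp (C D : category) (F G K : functor C D)
    (t : nat_trans G K) (s : nat_trans F G) : nat_trans F K :=
  NatTrans (nat_comp_subproof t s).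

Lemma nat_idl (C D : category) (F G : functor C D) (s : nat_trans F G) :
  nat_comp (nat_id G) s = s.
Proof. by apply: nat_trans_ext => A; apply: cat_id_left. Qed.

Lemma nat_idr (C D : category) (F G : functor C D) (s : nat_trans F G) :
  nat_comp s (nat_id F) = s.
Proof. by apply: nat_trans_ext => A; apply: cat_id_right. Qed.

Lemma nat_compA (C D : category) (F G K L : functor C D)
    (u : nat_trans K L) (t : nat_trans G K) (s : nat_trans F G) :
  nat_comp u (nat_comp t s) = nat_comp (nat_comp u t) s.
Proof. by apply: nat_trans_ext => A; apply: cat_assoc. Qed.

Definition functor_cat (C D : category) : category :=
  @Category (functor C D) (@nat_trans C D) (@nat_id C D) (@nat_comp C D)
    (@nat_idl C D) (@nat_idr C D) (@nat_compA C D).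

Lemma additive_ext (A B : zmodType) (f g : {additive A -> B}) :
  f =1 g -> f = g.
Proof.
case: f g => f [[fm]] [g [[gm]]] /= /funext E; subst g.
by rewrite (Prop_irrelevance fm gm).
Qed.

Definition additive_id (A : zmodType) : {additive A -> A} := idfun.

Definition additive_comp (A B D : zmodType)
    (g : {additive B -> D}) (f : {additive A -> B}) : {additive A -> D} :=
  g \o f.

Lemma additive_idl (A B : zmodType) (f : {additive A -> B}) :
  additive_comp (additive_id B) f = f.
Proof. exact: additive_ext. Qed.

Lemma additive_idr (A B : zmodType) (f : {additive A -> B}) :
  additive_comp f (additive_id A) = f.
Proof. exact: additive_ext. Qed.

Lemma additive_compA (A B D E : zmodType) (h : {additive D -> E})
    (g : {additive B -> D}) (f : {additive A -> B}) :
  additive_comp h (additive_comp g f) = additive_comp (additive_comp h g) f.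
Proof. exact: additive_ext. Qed.

(* The choice structure carried by a zmodType is no restriction: classically
   every type has one, and morphisms ignore it. *)
Definition Ab : category :=
  @Category zmodType (fun A B => {additive A -> B}) additive_id additive_comp
    additive_idl additive_idr additive_compA.

(* Arrow types are boolean inequalities, hence have at most one
   element. *)
Definition poset_cat (disp : Order.disp_t) (C : porderType disp) : category :=
  @Category C (fun p q => (p <= q)%O) (fun p => lexx p)
    (fun p q r (qr : (q <= r)%O) (pq : (p <= q)%O) => le_trans pq qr)
    (fun p q f => bool_irrelevance _ f)
    (fun p q f => bool_irrelevance _ f)
    (fun p q r s h g f => bool_irrelevance _ _).

Definition precedes (disp : Order.disp_t) (C : porderType disp) (p q : C) :
    Prop :=
  (p < q)%O /\ forall r : C, (p <= r <= q)%O -> r = p \/ r = q.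

Definition is_grading (disp : Order.disp_t) (C : porderType disp)
    (deg : C -> int) : Prop :=
  (forall p q : C, (p < q)%O -> deg p < deg q) /\
  (forall p q : C, precedes p q -> deg q = deg p + 1).

Definition bounded_above_grading (disp : Order.disp_t) (C : porderType disp)
    (deg : C -> int) : Prop :=
  exists N : int, forall p : C, deg p <= N.

Definition arrow_degree (disp : Order.disp_t) (C : porderType disp)
    (deg : C -> int) (p q : C) (f : @arrow (poset_cat C) p q) : int :=
  `|deg q - deg p|.

Definition ob_group (C : category) (H : functor C Ab) (i : C) : zmodType := H i.

Definition map_group (C : category) (H : functor C Ab) (i j : C)
  (f : arrow i j) : {additive ob_group H i -> ob_group H j} := fmap H f.

(* The arrows out of i0 have varying codomains, so they are compared with the
   identity as dependent pairs. *)
Definition is_identity (C : category) (i0 i : C) (f : arrow i0 i) : Prop :=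
  existT (arrow i0) i f = existT (arrow i0) i0 (idm i0).

Definition Ker_pred (C : category) (H : functor C Ab) (i0 : C) :
    {pred ob_group H i0} :=
  fun x => `[< forall (i : C) (f : arrow i0 i),
                 ~ is_identity f -> map_group H f x = 0 >].

Arguments Ker_pred {C} H i0 _.

Lemma Ker_pred_zmod_closed (C : category) (H : functor C Ab) (i0 : C) :
  zmod_closed (Ker_pred H i0).
Proof.
split=> [|x y /asboolP xK /asboolP yK]; apply/asboolP => i f fn1.
  exact: raddf0.
by rewrite raddfB xK // yK // subr0.
Qed.

HB.instance Definition _ (C : category) (H : functor C Ab) (i0 : C) :=
  GRing.isZmodClosed.Build (ob_group H i0) (Ker_pred H i0)
    (@Ker_pred_zmod_closed C H i0).

Record Ker_type (C : category) (H : functor C Ab) (i0 : C) := KerElt {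
  Ker_val :> ob_group H i0;
  Ker_valP : Ker_val \in Ker_pred H i0 }.

HB.instance Definition _ (C : category) (H : functor C Ab) (i0 : C) :=
  [isSub for @Ker_val C H i0].
HB.instance Definition _ (C : category) (H : functor C Ab) (i0 : C) :=
  [Choice of Ker_type H i0 by <:].
HB.instance Definition _ (C : category) (H : functor C Ab) (i0 : C) :=
  [SubChoice_isSubZmodule of Ker_type H i0 by <:].

Definition Ker (C : category) (H : functor C Ab) (i0 : C) : zmodType :=
  Ker_type H i0.

Definition pseudo_injective (disp : Order.disp_t) (C : porderType disp)
    (deg : C -> int) (H : functor (poset_cat C) Ab) : Prop :=
  forall d : int, 0 <= d ->
  forall (i0 : C) (J : Type) (i : J -> C), injective i ->
  forall a : (forall j : J, @arrow (poset_cat C) i0 (i j)),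
    (forall j : J, arrow_degree deg (a j) = d) ->
  forall x : (forall j : J, Ker H (i j)),
  exists y : ob_group H i0, forall j : J, map_group H (a j) y = \val (x j).

(* Main.v *)
(** If every [Ker H i] is injective, choose retractions [p i] of [H i] onto
    [Ker H i].  Both the existence and the uniqueness part of the following
    claim go by descending induction on the degree: an element [y] of [H j] is
    determined by the values [p i (H (j <= i) y)], [i >= j], and by
    pseudo-injectivity these values can be prescribed.  So [H] is the product
    of the right Kan extensions of its kernels, and a map into [H] extends as
    soon as the corresponding maps into the kernels do.

    Conversely, test the injectivity of [H] on functors that are constant on a
    convex set of objects and zero elsewhere: supported at one object they give
    the injectivity of the kernels, and the inclusion of the upward closure of
    the [i_j] into that of [i0], with values in the integers, gives
    pseudo-injectivity. *)
From HB Require Import structures.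
From mathcomp Require Import all_boot all_order all_algebra.
From mathcomp Require Import boolp zify.
Require Import Defs.

Set Implicit Arguments.
Unset Strict Implicit.
Unset Printing Implicit Defensive.

Import Order.TTheory GRing.Theory Num.Theory.
Local Open Scope ring_scope.

(** * Pointwise kernels and monomorphisms of functors into [Ab] *)

Definition additive_of (A B : zmodType) (f : A -> B)
    (fB : {morph f : x y / x - y}) : {additive A -> B} :=
  HB.pack f (GRing.isZmodMorphism.Build A B f fB).

Section Kernel.

Variables (A B : zmodType) (f : {additive A -> B}).

Definition kernel_pred : {pred A} := fun a => f a == 0.

Lemma kernel_pred_zmod_closed : zmod_closed kernel_pred.
Proof.
split=> [|x y]; first by rewrite unfold_in raddf0.
by rewrite !unfold_in raddfB => /eqP-> /eqP->; rewrite subr0.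
Qed.

HB.instance Definition _ :=
  GRing.isZmodClosed.Build A kernel_pred kernel_pred_zmod_closed.

Record kernel := KernelElt { kernel_val :> A; _ : kernel_val \in kernel_pred }.

HB.instance Definition _ := [isSub for kernel_val].
HB.instance Definition _ := [Choice of kernel by <:].
HB.instance Definition _ := [SubChoice_isSubZmodule of kernel by <:].

End Kernel.

Section FunctorMono.

Variables (C : category) (F G : functor C Ab) (m : nat_trans F G).

Lemma functor_mapC (A B : C) (a : arrow A B) (x : F A) :
  (m B : {additive _ -> _}) ((fmap F a : {additive _ -> _}) x)
    = (fmap G a : {additive _ -> _}) ((m A : {additive _ -> _}) x).
Proof.
exact: (congr1 (fun u : {additive _ -> _} => u x) (naturality m a)).
Qed.

Let K (A : C) : zmodType := kernel (m A : {additive F A -> G A}).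

Lemma kernel_map_subproof (A B : C) (a : arrow A B) (x : K A) :
  (fmap F a : {additive _ -> _}) (val x)
    \in kernel_pred (m B : {additive F B -> G B}).
Proof.
have /eqP mx0 := valP x.
by rewrite unfold_in functor_mapC mx0 raddf0.
Qed.

Definition kernel_map (A B : C) (a : arrow A B) (x : K A) : K B :=
  KernelElt (kernel_map_subproof a x).

Lemma kernel_mapB (A B : C) (a : arrow A B) :
  {morph kernel_map a : x y / x - y}.
Proof. by move=> x y; apply: val_inj; rewrite /= raddfB. Qed.

Definition kernel_functor : functor C Ab.
Proof.
refine (@Functor C Ab K (fun A B a => additive_of (@kernel_mapB A B a)) _ _).
- move=> A; apply: additive_ext => x; apply: val_inj => /=.
  by rewrite functor_id.
- move=> A B E g f; apply: additive_ext => x; apply: val_inj => /=.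
  by rewrite functor_comp.
Defined.

Lemma kernel_valB (A : C) : {morph (val : K A -> F A) : x y / x - y}.
Proof. by []. Qed.

Definition kernel_incl : nat_trans kernel_functor F.
Proof.
refine (@NatTrans C Ab kernel_functor F
  (fun A => additive_of (@kernel_valB A)) _).
by move=> A B a; apply: additive_ext.
Defined.

Lemma zeroB (A B : zmodType) :
  {morph (fun=> 0) : x y / x - y :> A >-> x - y :> B}.
Proof. by move=> x y; rewrite subr0. Qed.

Definition kernel_zero : nat_trans kernel_functor F.
Proof.
refine (@NatTrans C Ab kernel_functor F
  (fun A => additive_of (@zeroB (K A) (F A))) _).
by move=> A B a; apply: additive_ext => x /=; rewrite raddf0.
Defined.

(** The inclusion of the pointwise kernel of [m] and the zero transformation both become zero after
    composition with [m], so they coincide. Hence the kernel vanishes at each object, and it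
    contains every difference [u z - v z]. *)
Lemma functor_mono_component :
  @monomorphism (functor_cat C Ab) F G m ->
  forall A : C, @monomorphism Ab _ _ (m A).
Proof.
move=> mono_m A Z u v muv; apply: additive_ext => z.
have incl0 : kernel_incl = kernel_zero.
  apply: (mono_m kernel_functor); apply: nat_trans_ext => B.
  by apply: additive_ext => x /=; rewrite raddf0; apply/eqP/(valP x).
have kz : u z - v z \in kernel_pred (m A : {additive F A -> G A}).
  rewrite unfold_in raddfB subr_eq0; apply/eqP.
  exact: (congr1 (fun w : {additive _ -> _} => w z) muv).
apply/eqP; rewrite -subr_eq0; apply/eqP.
by have := congr1 (fun s : nat_trans kernel_functor F =>
  (s A : {additive K A -> F A}) (KernelElt kz)) incl0.
Qed.

End FunctorMono.

(** * Functors constant on a convex set and zero elsewhere *)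

Section Support.

(* Imposing [b || (a == 0)] on elements of a fixed group lets a functor that is
   [A] on some objects and [0] on others avoid dependent casts. *)
Variables (b : bool) (A : zmodType).

Definition supp_pred : {pred A} := fun a => b || (a == 0).

Lemma supp_pred_zmod_closed : zmod_closed supp_pred.
Proof.
rewrite /supp_pred; split=> [|x y]; rewrite !unfold_in ?eqxx ?orbT //.
by case: b => //= /eqP-> /eqP->; rewrite subr0.
Qed.

HB.instance Definition _ :=
  GRing.isZmodClosed.Build A supp_pred supp_pred_zmod_closed.

Record supp := SuppElt { supp_val :> A; _ : supp_val \in supp_pred }.

HB.instance Definition _ := [isSub for supp_val].
HB.instance Definition _ := [Choice of supp by <:].
HB.instance Definition _ := [SubChoice_isSubZmodule of supp by <:].

Lemma supp_or0 (x : supp) : b \/ val x = 0.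
Proof.
by case: x => x /=; rewrite unfold_in => /orP[|/eqP]; [left | right].
Qed.

Lemma supp_eq0 (x : supp) : ~~ b -> val x = 0.
Proof. by have [->|] := supp_or0 x. Qed.

Lemma supp_of_subproof (a : A) : (if b then a else 0) \in supp_pred.
Proof. by rewrite unfold_in; case: b; rewrite ?eqxx. Qed.

Definition supp_of (a : A) : supp := SuppElt (supp_of_subproof a).

Lemma val_suppK : cancel val supp_of.
Proof.
move=> x; apply: val_inj => /=.
by case: (boolP b) => // nb; rewrite [RHS](supp_eq0 x nb).
Qed.

End Support.

Lemma supp_mapB (b c : bool) (A B : zmodType) (f : {additive A -> B}) :
  {morph (fun x : supp b A => supp_of c (f (val x))) : x y / x - y}.
Proof.
move=> x y; apply: val_inj; rewrite /= raddfB /=.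
by case: c; rewrite ?subr0.
Qed.

Definition supp_map (b c : bool) (A B : zmodType) (f : {additive A -> B}) :
  {additive supp b A -> supp c B} := additive_of (@supp_mapB b c A B f).

Lemma val_suppB (b : bool) (A : zmodType) :
  {morph (val : supp b A -> A) : x y / x - y}.
Proof. by []. Qed.

Lemma supp_ofB (b : bool) (A : zmodType) :
  {morph (@supp_of b A) : x y / x - y}.
Proof.
by move=> x y; apply: val_inj => /=; case: b; rewrite ?subr0.
Qed.

Section PosetFunctors.

Variables (disp : Order.disp_t) (C : porderType disp).

Definition convex (P : pred C) :=
  forall p q r : C, (p <= q)%O -> (q <= r)%O -> P p -> P r -> P q.

(** Convexity rules out [p <= q <= r] with [A] at both ends and [0] at [q], where the composite
    would be zero but the direct map the identity. *)
Definition supp_functor (P : pred C) (cP : convex P) (A : zmodType) :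
  functor (poset_cat C) Ab.
Proof.
refine (@Functor (poset_cat C) Ab (fun p => supp (P p) A)
  (fun p q _ => supp_map (P p) (P q) (additive_id A)) _ _).
- by move=> p; apply: additive_ext => x; apply: val_suppK.
- move=> p q r g f; apply: additive_ext => x; apply: val_inj => /=.
  have [Pp|x0] := supp_or0 x; last by rewrite [supp_val x]x0 !if_same.
  by case Pr: (P r) => //; rewrite (cP p q r f g Pp Pr).
Defined.

(** Naturality could fail only at an arrow from a point of [P] to a point of [Q] outside [P]; [QP]
    excludes such arrows. *)
Definition supp_trans (P Q : pred C) (cP : convex P) (cQ : convex Q)
    (PQ : subpred P Q)
    (QP : forall p q : C, (p <= q)%O -> P p -> Q q -> P q)
    (A B : zmodType) (f : {additive A -> B}) :
  nat_trans (supp_functor cP A) (supp_functor cQ B).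
Proof.
refine (@NatTrans (poset_cat C) Ab (supp_functor cP A) (supp_functor cQ B)
  (fun p => supp_map (P p) (Q p) f) _).
move=> p q a; apply: additive_ext => x; apply: val_inj => /=.
have [Pp|x0] := supp_or0 x; last first.
  by rewrite [supp_val x]x0 !(if_same, raddf0).
by case Qq: (Q q) => //; rewrite (PQ _ Pp) (QP _ _ a Pp Qq).
Defined.

Lemma supp_trans_mono (P Q : pred C) (cP : convex P) (cQ : convex Q)
    (PQ : subpred P Q)
    (QP : forall p q : C, (p <= q)%O -> P p -> Q q -> P q)
    (A B : zmodType) (f : {additive A -> B}) :
  @monomorphism Ab A B f ->
  @monomorphism (functor_cat (poset_cat C) Ab) _ _ (supp_trans cP cQ PQ QP f).
Proof.
move=> mono_f Z u v fuv; apply: nat_trans_ext => p; apply: additive_ext => z.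
apply: val_inj.
have [Pp|nP] := pselect (P p); last by rewrite !supp_eq0 //; apply/negP.
pose valu (w : nat_trans Z (supp_functor cP A)) : {additive Z p -> A} :=
  additive_comp (additive_of (@val_suppB (P p) A)) (w p).
suff : valu u = valu v.
  by move/(congr1 (fun w : {additive _ -> _} => w z)).
apply: mono_f; apply: additive_ext => y.
have := congr1 (fun s : nat_trans Z (supp_functor cQ B) =>
  val ((s p : {additive Z p -> supp (Q p) B}) y)) fuv.
by rewrite /= (PQ _ Pp).
Qed.

Lemma is_identityE (p q : C) (f : @arrow (poset_cat C) p q) :
  is_identity f <-> q = p.
Proof.
split=> [/(congr1 (@projT1 _ _)) //|pq].
by subst q; rewrite /is_identity (bool_irrelevance f (lexx p)).
Qed.

End PosetFunctors.

(** * Values of [H] and its kernels along the arrows of a poset *)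

Section PosetKer.

Variables (disp : Order.disp_t) (C : porderType disp).
Variable H : functor (poset_cat C) Ab.

Lemma KerP (p : C) (x : ob_group H p) :
  reflect (forall (q : C) (f : @arrow (poset_cat C) p q), q <> p ->
             map_group H f x = 0) (x \in Ker_pred H p).
Proof.
apply: (iffP idP) => [/asboolP xK q f qp|xK].
  by apply: xK => /is_identityE.
by apply/asboolP => q f qp; apply: xK => /is_identityE.
Qed.

Lemma map_group_id (p : C) (f : @arrow (poset_cat C) p p) x :
  map_group H f x = x.
Proof. by rewrite /map_group (bool_irrelevance f (lexx p)) functor_id. Qed.

Lemma map_group_comp (p q r : C) (g : @arrow (poset_cat C) q r)
    (f : @arrow (poset_cat C) p q) (h : @arrow (poset_cat C) p r) x :
  map_group H g (map_group H f x) = map_group H h x.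
Proof.
by rewrite /map_group (bool_irrelevance h (catcomp g f)) functor_comp.
Qed.

Lemma map_group_Ker (p q : C) (f : @arrow (poset_cat C) p q) (x : Ker H p) :
  q <> p -> map_group H f (val x) = 0.
Proof. by move=> qp; apply: (KerP _ (Ker_valP x)). Qed.

End PosetKer.

Lemma le_degree (disp : Order.disp_t) (C : porderType disp) (deg : C -> int) :
  is_grading deg -> {homo deg : p q / (p <= q)%O >-> p <= q}.
Proof.
move=> grading_deg p q; rewrite le_eqVlt => /orP[/eqP->//|/grading_deg.1].
exact: ltW.
Qed.

(** * Consequences of the injectivity of [H] *)

Section Injective.

Variables (disp : Order.disp_t) (C : porderType disp) (deg : C -> int).
Variable H : functor (poset_cat C) Ab.
Hypothesis injH : @injective_object (functor_cat (poset_cat C) Ab) H.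

Lemma convex_pred1 (p : C) : convex (pred1 p).
Proof.
move=> x q r xq qr /= /eqP xp /eqP rp.
by rewrite eq_le -{1}rp qr -xp xq.
Qed.

Lemma convex_up (P : pred C) :
  (forall p q : C, (p <= q)%O -> P p -> P q) -> convex P.
Proof. by move=> uP p q r pq _ Pp _; apply: uP pq Pp. Qed.

Lemma injective_Ker (p : C) : @injective_object Ab (Ker H p).
Proof.
move=> A B m mono_m g.
(* The transformation given by [g] at [p] and by [0] elsewhere; the cast is needed because the
   target group depends on [q]. It is natural because a nonidentity arrow out of [p] kills
   [Ker H p]. *)
have g'B q : {morph (fun x : supp (pred1 p q) A =>
    (if (pselect (p = q)) is left e then
      ecast q (ob_group H q) e (val (g (val x))) else 0 : ob_group H q))
    : x y / x - y}.
  move=> x y; case: pselect => [e|_]; last by rewrite subr0.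
  by subst q; rewrite /= raddfB.
have cp := @convex_pred1 p.
have g'N : forall (q r : C) (a : @arrow (poset_cat C) q r),
  @catcomp Ab _ _ _ (additive_of (@g'B r)) (fmap (supp_functor cp A) a)
  = @catcomp Ab _ _ _ (fmap H a) (additive_of (@g'B q)).
  move=> q r a; apply: additive_ext => x /=.
  case: pselect => [e|pr]; case: pselect => [e'|pq] /=.
  - subst r; subst q => /=; rewrite ifT ?eqxx //.
    by rewrite -[LHS](map_group_id a).
  - rewrite raddf0; subst r; rewrite /= eqxx.
    have -> : supp_val x = 0.
      by apply: supp_eq0; apply/eqP => qp; apply: pq.
    by rewrite raddf0.
  - subst q; rewrite /=; symmetry; apply: map_group_Ker => rp; exact: pr.
  - by rewrite raddf0.
have QP (q r : C) : (q <= r)%O -> pred1 p q -> pred1 p r -> pred1 p r by [].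
have PP : subpred (pred1 p) (pred1 p) by [].
have [h hm] := injH (supp_trans_mono (cP := cp) (cQ := cp)
    (PQ := PP) (QP := QP) mono_m)
  (@NatTrans (poset_cat C) Ab (supp_functor cp A) H _ g'N).
pose k : {additive B -> ob_group H p} :=
  additive_comp (h p : {additive _ -> _})
    (additive_of (@supp_ofB (pred1 p p) B)).
(* By naturality of [h], the image along an arrow from [p] to [q <> p] factors through the value at
   [q] of the functor supported at [p], which is zero. *)
have kK b : k b \in Ker_pred H p.
  apply/KerP => q f qp; apply: etrans (esym (functor_mapC h f _)) _.
  rewrite -[RHS](raddf0 (h q : {additive supp (pred1 p q) B -> H q})).
  by congr (h q _); apply: val_inj => /=; case: eqP.
have kB : {morph (fun b => KerElt (kK b) : Ker H p) : x y / x - y}.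
  by move=> x y; apply: val_inj; apply: (raddfB k).
exists (additive_of kB); apply: additive_ext => a; apply: val_inj.
have := congr1 (fun s : nat_trans (supp_functor cp A) H =>
  (s p : {additive supp (pred1 p p) A -> H p}) (supp_of (pred1 p p) a)) hm.
rewrite /=; case: pselect => // e.
by rewrite (Prop_irrelevance e erefl) /= ifT ?eqxx.
Qed.

Hypothesis grading_deg : is_grading deg.

Lemma injective_pseudo_injective : pseudo_injective deg H.
Proof.
move=> d _ i0 J i inj_i a deg_a x.
have degi j : deg (i j) = deg i0 + d.
  have := deg_a j; rewrite /arrow_degree.
  have := le_degree grading_deg (a j).
  by lia.
(* The [i j] share one degree, so distinct ones are incomparable. *)
have anti j k : (i j <= i k)%O -> j = k.
  rewrite le_eqVlt => /orP[/eqP/inj_i //|/grading_deg.1].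
  by rewrite !degi ltxx.
pose Q (p : C) := (i0 <= p)%O.
pose P (p : C) := `[< exists j, (i j <= p)%O >].
have uQ (p q : C) : (p <= q)%O -> Q p -> Q q by move=> pq /le_trans; apply.
have uP (p q : C) : (p <= q)%O -> P p -> P q.
  by move=> pq /asboolP[j jp]; apply/asboolP; exists j; apply: le_trans pq.
have PQ : subpred P Q.
  by move=> p /asboolP[j]; apply: le_trans; exact: (a j).
have QP (p q : C) : (p <= q)%O -> P p -> Q q -> P q by move=> pq /(uP _ _ pq).
(* The image of the generator [1] at [p]: [x j] if [p] is [i j], and [0] at all other objects. *)
pose e (p : C) : ob_group H p :=
  if pselect (exists j, i j = p) is left E then
    let: exist j ij := cid E in ecast q (ob_group H q) ij (val (x j))
  else 0.
have ei j : e (i j) = val (x j).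
  rewrite /e; case: pselect => [E|[]]; last by exists j.
  case: (cid E) => k /= ik; have jk := inj_i _ _ ik; subst k.
  by rewrite (Prop_irrelevance ik erefl).
have eN p : (forall j, i j <> p) -> e p = 0.
  by move=> np; rewrite /e; case: pselect => // E; case: E (E) => j /np.
have gB p : {morph (fun n : supp (P p) int => e p *~ val n) : m n / m - n}.
  by move=> m n; rewrite /= mulrzBr.
have gN : forall (p q : C) (f : @arrow (poset_cat C) p q),
  @catcomp Ab _ _ _ (additive_of (@gB q))
    (fmap (supp_functor (convex_up uP) int) f)
  = @catcomp Ab _ _ _ (fmap H f) (additive_of (@gB p)).
  move=> p q f; apply: additive_ext => n /=.
  have [Pp|n0] := supp_or0 n; last first.
    by rewrite [supp_val n]n0 if_same !mulr0z raddf0.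
  rewrite (uP _ _ f Pp) raddfMz; congr (_ *~ _).
  have [qp|pq] := pselect (q = p).
    by subst q; rewrite [RHS](map_group_id f).
  (* A point [q] strictly above a point [p] of [P] is no [i j]: it would lie above some [i k <= p],
     forcing [k = j] and then [p = q]. *)
  have -> : e q = 0.
    apply: eN => j jq; move/asboolP: Pp => [k kp].
    have kj : k = j by apply: anti; rewrite jq; apply: le_trans kp f.
    by apply: pq; apply/eqP; rewrite eq_le [(p <= q)%O]f -jq -kj kp.
  have [[j jp]|np] := pselect (exists j, i j = p).
    by subst p; rewrite ei [RHS]map_group_Ker.
  by rewrite eN ?raddf0 // => j jp; apply: np; exists j.
have mono_id : @monomorphism Ab int int (additive_id int).
  by move=> Z u v uv; apply: additive_ext => z;
     exact: (congr1 (fun w : {additive _ -> _} => w z) uv).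
have [h hm] := injH (supp_trans_mono (cP := convex_up uP) (cQ := convex_up uQ)
    (PQ := PQ) (QP := QP) mono_id)
  (@NatTrans (poset_cat C) Ab (supp_functor (convex_up uP) int) H _ gN).
(* The generator at [i0] is carried to the generator at [i j], whose image under the extension [h]
   is [x j]. *)
exists ((h i0 : {additive _ -> _}) (supp_of (Q i0) 1)) => j.
rewrite /map_group -functor_mapC.
have := congr1 (fun s : nat_trans (supp_functor (convex_up uP) int) H =>
  (s (i j) : {additive supp (P (i j)) int -> H (i j)})
    (supp_of (P (i j)) 1)) hm.
have Pj : P (i j) by apply/asboolP; exists j.
rewrite /= Pj ei mulr1z => <-; congr (h (i j) _); apply: val_inj => /=.
by rewrite /Q lexx.
Qed.

End Injective.

(** * Coordinates of [H] in its kernels, by descending induction on the degree *)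

Section PseudoInjective.

Variables (disp : Order.disp_t) (C : porderType disp) (deg : C -> int).
Hypothesis grading_deg : is_grading deg.

(** Strong induction on the degree gap. If [d] lies strictly between the two degrees, the gap is at
    least 2, so [p] does not precede [q]; a point strictly in between splits the gap into two
    smaller ones, one of which contains [d]. *)
Lemma exists_degree_between (p q : C) (d : int) :
  (p <= q)%O -> deg p <= d -> d <= deg q ->
  exists r : C, [/\ (p <= r)%O, (r <= q)%O & deg r = d].
Proof.
have [n] := ubnP `|deg q - deg p|%N; elim: n => // n IHn in p q *.
move=> len pq pd dq.
have [->|pd'] := eqVneq d (deg p); first by exists p.
have [->|dq'] := eqVneq d (deg q); first by exists q.
have ltpq : (p < q)%O.
  by rewrite lt_neqAle pq andbT; apply/eqP => pq'; subst q; lia.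
have npq : ~ precedes p q by move/grading_deg.2; lia.
have [r [/andP[pr rq] rp r_q]] :
    exists r : C, [/\ (p <= r <= q)%O, r <> p & r <> q].
  apply: contrapT => nr; apply: npq; split=> // r prq.
  apply: contrapT => /not_orP[rp rq]; apply: nr; by exists r.
have ltpr : deg p < deg r.
  by apply: grading_deg.1; rewrite lt_neqAle pr andbT; apply/eqP => /esym.
have ltrq : deg r < deg q.
  by apply: grading_deg.1; rewrite lt_neqAle rq andbT; apply/eqP.
have [dr|rd] := leP d (deg r).
  have [|s [ps sr sd]] := IHn p r _ pr pd dr; first by lia.
  by exists s; split=> //; apply: le_trans rq.
have [|s [rs sq sd]] := IHn r q _ rq (ltW rd) dq; first by lia.
by exists s; split=> //; apply: le_trans rs.
Qed.

Variable N : int.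
Hypothesis leN : forall p : C, deg p <= N.
Variable H : functor (poset_cat C) Ab.
Variable proj : forall p : C, {additive ob_group H p -> Ker H p}.
Hypothesis projK : forall (p : C) (x : Ker H p), proj p (val x) = x.

(** If the images of [y] vanish in all degrees above that of [q], then its image at [q] lies in
    [Ker H q], which [proj q] fixes. The induction starts vacuously above the bound [N]. *)
Lemma proj_eq0 (p : C) (y : ob_group H p) :
  (forall (q : C) (f : @arrow (poset_cat C) p q),
     proj q (map_group H f y) = 0) -> y = 0.
Proof.
move=> y0.
have vanish (n : nat) : forall (q : C) (f : @arrow (poset_cat C) p q),
    N - n%:Z < deg q -> map_group H f y = 0.
  elim: n => [|n IHn] q f nq; first by have := leN q; lia.
  have yK : map_group H f y \in Ker_pred H q.
    apply/KerP => r g rq; have gf : (p <= r)%O := le_trans f g.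
    rewrite (map_group_comp g f gf); apply: IHn.
    have : deg q < deg r.
      apply: grading_deg.1; rewrite lt_neqAle [(q <= r)%O]g andbT.
      by apply/eqP => e; apply: rq.
    by lia.
  have := projK (KerElt yK : Ker H q); rewrite y0.
  by move/(congr1 val).
rewrite -(map_group_id (lexx p : @arrow (poset_cat C) p p) y).
(* With this [n] the threshold [N - n] is [deg p - 1], just below the degree of [p]. *)
by apply: (vanish `|N - deg p|.+1); lia.
Qed.

Hypothesis pinjH : pseudo_injective deg H.

Lemma proj_onto (p : C) (x : forall q, Ker H q) :
  exists y : ob_group H p, forall (q : C) (f : @arrow (poset_cat C) p q),
    proj q (map_group H f y) = x q.
Proof.
suff approx (n : nat) : exists y : ob_group H p,
    forall (q : C) (f : @arrow (poset_cat C) p q),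
    N - n%:Z < deg q -> proj q (map_group H f y) = x q.
  have [y yP] := approx `|N - deg p|.+1; exists y => q f; apply: yP.
  by have := le_degree grading_deg f; lia.
elim: n => [|n [y yP]]; first by exists 0 => q f; have := leN q; lia.
(* The next level to treat: [y] is already correct in degrees above [N - n]. *)
pose J := {q : C | (p <= q)%O && (deg q == N - n%:Z)}.
pose a (j : J) : @arrow (poset_cat C) p (val j) :=
  proj1 (andP (valP j)).
have degJ (j : J) : deg (val j) = N - n%:Z by apply/eqP; case/andP: (valP j).
have [ltd|led] := ltP (N - n%:Z) (deg p).
  exists y => q f nq; apply: yP.
  by have := le_degree grading_deg f; lia.
have d_ge0 : 0 <= N - n%:Z - deg p by lia.
(* Pseudo-injectivity yields a correction [z] whose values on this level are the errors of [y]. *)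
have [|z zP] := pinjH d_ge0 (@val_inj _ _ J) (a := a) _
    (fun j => x (val j) - proj (val j) (map_group H (a j) y)).
  by move=> j; rewrite /arrow_degree degJ ger0_norm.
exists (y + z) => q f nq; rewrite !raddfD.
have [nq'|qn] := ltP (N - n%:Z) (deg q).
  (* The correction changes nothing in higher degrees: the arrow to [q] passes through a point [r]
     of the level, where [z] has a value in [Ker H r], which is killed on the way to [q]. *)
  have [r [pr rq dr]] := exists_degree_between f led (ltW nq').
  have jP : (p <= r)%O && (deg r == N - n%:Z) by rewrite pr dr eqxx.
  pose j : J := exist _ r jP.
  rewrite yP // -(map_group_comp (rq : @arrow (poset_cat C) (val j) q) (a j)).
  rewrite zP map_group_Ker ?raddf0 ?addr0 //= => qr.
  by move: nq'; rewrite qr dr ltxx.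
have jP : (p <= q)%O && (deg q == N - n%:Z).
  by rewrite [(p <= q)%O]f /=; apply/eqP; lia.
pose j : J := exist _ q jP.
have := zP j; rewrite (bool_irrelevance (a j) f) /= => ->.
by rewrite [X in _ + X](projK (x q - _)) addrC subrK.
Qed.

End PseudoInjective.

(** * The equivalence, with the extension of maps into [H] *)

Theorem theorem13 (disp : Order.disp_t) (C : porderType disp)
    (deg : C -> int) (H : functor (poset_cat C) Ab) :
  is_grading deg -> bounded_above_grading deg ->
  @injective_object (functor_cat (poset_cat C) Ab) H <->
  (forall i0 : C, @injective_object Ab (Ker H i0)) /\
  pseudo_injective deg H.
Proof.
move=> grading_deg [N leN]; split=> [injH|[injK pinjH]].
  split; first exact: injective_Ker.
  exact: injective_pseudo_injective.
have incl_mono (p : C) : @monomorphism Ab (Ker H p) (ob_group H p)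
    (val : {additive _ -> _}).
  move=> Z u v uv; apply: additive_ext => z; apply: val_inj.
  exact: (congr1 (fun w : {additive _ -> _} => w z) uv).
have proj_exists (p : C) :
    exists r : {additive ob_group H p -> Ker H p},
    forall x : Ker H p, r (val x) = x.
  (* Extending the identity of [Ker H p] along its inclusion gives a retraction. *)
  have [r rE] := injK p _ _ _ (incl_mono p) (additive_id (Ker H p)).
  exists r => x.
  exact: (congr1 (fun w : {additive _ -> _} => w x) rE).
pose proj p := projT1 (cid (proj_exists p)).
have projK p : forall x : Ker H p, proj p (val x) = x :=
  projT2 (cid (proj_exists p)).
have proj_inj p (y z : ob_group H p) :
    (forall (q : C) (f : @arrow (poset_cat C) p q),
       proj q (map_group H f y) = proj q (map_group H f z)) -> y = z.
  move=> yz; apply/eqP; rewrite -subr_eq0; apply/eqP.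
  apply: (proj_eq0 grading_deg leN projK) => q f.
  by rewrite !raddfB yz subrr.
move=> A B m mono_m g.
(* The coordinates of [g] extend one object at a time, with no compatibility required between
   different objects. *)
have ext_exists (p : C) : exists e : {additive ob_group B p -> Ker H p},
    forall x, e ((m p : {additive _ -> _}) x)
              = proj p ((g p : {additive _ -> _}) x).
  have [e eE] := injK p _ _ _ (functor_mono_component mono_m (A := p))
    (additive_comp (proj p) (g p)).
  exists e => x.
  exact: (congr1 (fun w : {additive _ -> _} => w x) eE).
pose e p := projT1 (cid (ext_exists p)).
have eP p := projT2 (cid (ext_exists p)) : forall x, e p _ = _.
have lift_exists (p : C) (b : ob_group B p) : exists y : ob_group H p,
    forall (q : C) (f : @arrow (poset_cat C) p q),
    proj q (map_group H f y) = e q (map_group B f b).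
  (* The family must be defined at every [q]; the value [0] at objects not above [p] is
     arbitrary. *)
  have [y yP] := proj_onto grading_deg leN projK pinjH p (fun q =>
    if pselect (p <= q)%O is left f then
      e q (@map_group (poset_cat C) B p q f b) else 0).
  exists y => q f; rewrite yP; case: pselect => [f'|[]]; last exact: f.
  by rewrite (bool_irrelevance f' f).
pose h p b := projT1 (cid (lift_exists p b)).
have hP p b : forall (q : C) (f : @arrow (poset_cat C) p q),
    proj q (map_group H f (h p b)) = e q (map_group B f b)
  := projT2 (cid (lift_exists p b)).
(* Although [h] is chosen pointwise, its additivity and naturality follow from the uniqueness of an
   element with given coordinates. *)
have hB p : {morph h p : x y / x - y}.
  by move=> x y; apply: proj_inj => q f; rewrite hP !raddfB !hP.
have hN : forall (p q : C) (f : @arrow (poset_cat C) p q),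
  @catcomp Ab _ _ _ (additive_of (@hB q)) (fmap B f)
  = @catcomp Ab _ _ _ (fmap H f) (additive_of (@hB p)).
  move=> p q f; apply: additive_ext => b /=; apply: proj_inj => r k.
  have kf : (p <= r)%O := le_trans f k.
  rewrite hP [map_group B k _](map_group_comp k f kf).
  by rewrite [map_group H k _](map_group_comp k f kf) hP.
exists (@NatTrans (poset_cat C) Ab B H _ hN).
apply: nat_trans_ext => p; apply: additive_ext => x /=.
apply: proj_inj => q f.
by rewrite hP /map_group -!functor_mapC eP.
Qed.
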